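(* Let $K$ be a field and let $f=f(x_1,\ldots,x_n)$ be any polynomial in the free algebra $K\langle X\rangle$. Then the polynomial $g$ defined by $$g(x_1,\ldots,x_{n+1})=[f(x_1,\ldots,x_n),x_{n+1}]$$ is ideally concise.
   Context: ''Algebra'' means a not necessarily unital associative algebra over the fixed field $K$. $K\langle X\rangle$ is the free associative $K$-algebra on $X=\{x_1,x_2,\ldots\}$; polynomials are taken with zero constant term, so that they can be evaluated in any algebra. $[a,b]=ab-ba$. For an algebra $A$ and a polynomial $h=h(x_1,\ldots,x_k)\in K\langle X\rangle$, let $\mathcal S_A(h)$ and $\mathcal I_A(h)$ be, respectively, the $K$-subspace and the two-sided ideal of $A$ generated by the set of $h$-values $\{h(a_1,\ldots,a_k): a_1,\ldots,a_k\in A\}$. The polynomial $h$ is ideally concise if, for every $K$-algebra $A$, $\mathcal I_A(h)$ is finite-dimensional whenever $\mathcal S_A(h)$ is finite-dimensional. *)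

(* Defs.v *)
From HB Require Import structures.
From mathcomp Require Import all_boot all_algebra.
From mathcomp Require Import finmap monalg.
From mathcomp Require Import boolp classical_sets.

Set Implicit Arguments.
Unset Strict Implicit.
Unset Printing Implicit Defensive.

Import GRing.Theory.

Local Open Scope classical_set_scope.
Local Open Scope ring_scope.

(* Associative, not necessarily unital algebras; MathComp's [algType] is unital. *)
HB.mixin Record Lmodule_isNuAlgebra (K : fieldType) A of GRing.Lmodule K A := {
  numul : A -> A -> A;
  numulA : associative numul;
  numulDl : left_distributive numul +%R;
  numulDr : right_distributive numul +%R;
  numulZl : forall (c : K) (x y : A), numul (c *: x) y = c *: numul x y;
  numulZr : forall (c : K) (x y : A), numul x (c *: y) = c *: numul x y
}.

#[short(type="nuAlgType")]
HB.structure Definition NuAlgebra (K : fieldType) :=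
  { A of GRing.Lmodule K A & Lmodule_isNuAlgebra K A }.

Notation "{ 'ncpoly' K }" := {malg K[{fmonom nat}]}
  (at level 0, K at level 2, format "{ 'ncpoly'  K }") : type_scope.

Section FreeAlgebra.
Context (K : fieldType).
Implicit Types (h p q : {ncpoly K}).

(* Indices start at 0: [ncX K i] is the variable usually written x_(i+1). *)
Definition ncX (i : nat) : {ncpoly K} := << fmu i >>.

Definition const_free h : Prop := h@_(mone : {fmonom nat}) = 0.

(* [h] is a polynomial h(x_1, ..., x_n). *)
Definition in_vars (n : nat) h : Prop :=
  forall w : {fmonom nat}, w \in msupp h -> all (fun i => (i < n)%N) w.

Definition commutator p q : {ncpoly K} := p * q - q * p.

End FreeAlgebra.

Arguments ncX K i : clear implicits.

Section Evaluation.
Context (K : fieldType) (A : nuAlgType K).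

(* The empty word has no value in a non-unital algebra; 0 is a dummy value,
   which does not matter for polynomials with zero constant term. *)
Definition word_eval (a : nat -> A) (w : {fmonom nat}) : A :=
  if fmonom_val w is i :: s then foldl (fun b j => numul b (a j)) (a i) s
  else 0.

Definition nceval (a : nat -> A) (h : {ncpoly K}) : A :=
  \sum_(w <- msupp h) h@_w *: word_eval a w.

(* All variables are assigned a value, but only those occurring in [h] matter:
   see [eq_nceval]. *)
Definition values (h : {ncpoly K}) : set A := range (fun a => nceval a h).

Lemma eq_nceval (n : nat) (h : {ncpoly K}) (a b : nat -> A) :
  in_vars n h -> (forall i, (i < n)%N -> a i = b i) -> nceval a h = nceval b h.
Proof.
move=> hn ab; apply: eq_big_seq => w /hn; rewrite /word_eval.
case: (fmonom_val w) => [//|i s] /= /andP[/ab-> sn]; congr (_ *: _).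
elim: s (b i) sn => //= j s IHs x /andP[/ab-> sn]; exact: IHs.
Qed.

End Evaluation.

Arguments values {K} A h.

Section Subspaces.
Context (K : fieldType) (A : nuAlgType K).
Implicit Types (S V I : set A).

Definition subspace V : Prop := submod_closed (mem V).

Definition two_sided_ideal I : Prop :=
  subspace I /\ forall a x : A, I x -> I (numul a x) /\ I (numul x a).

Definition spanned S : set A := smallest subspace S.

Definition ideal_generated S : set A := smallest two_sided_ideal S.

Definition finite_dimensional V : Prop :=
  exists s : seq A, V = spanned [set` s].

End Subspaces.

Definition ideally_concise (K : fieldType) (h : {ncpoly K}) : Prop :=
  forall A : nuAlgType K,
    finite_dimensional (spanned (values A h)) ->
    finite_dimensional (ideal_generated (values A h)).

(* Main.v *)
(** Write S for the span of the values [v, b] of g, where v is a value of f and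
    b is arbitrary.  Since [v, b] c = [v, b c] - b [v, c], the left ideal
    S + A S is two-sided, so it is the ideal generated by S.  Reading the same
    identity as a [v, b] = [v, a b] - [v, a] b shows that A [v, b] lies in
    S + S b.  If S is finite-dimensional, it is spanned by finitely many values
    [v_i, b_i], and then the ideal is S + \sum_i S b_i. *)
From HB Require Import structures.
Require Import Defs.
From mathcomp Require Import all_boot all_algebra.
From mathcomp Require Import finmap monalg.
From mathcomp Require Import boolp classical_sets.

Set Implicit Arguments.
Unset Strict Implicit.
Unset Printing Implicit Defensive.

Import GRing.Theory.

Local Open Scope classical_set_scope.
Local Open Scope ring_scope.

(** * Subspaces, linear spans and bilinearity of the product *)

Section Subspaces.
Context (K : fieldType) (A : nuAlgType K).
Implicit Types (S T V : set A) (x y : A).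

Lemma subspaceP V :
  subspace V <-> V 0 /\ forall c x y, V x -> V y -> V (c *: x + y).
Proof.
split=> [[V0 Vl]|[V0 Vl]]; split.
- by move: V0; rewrite in_setE.
- by move=> c x y Vx Vy; have := Vl c x y; rewrite !in_setE; apply.
- by rewrite in_setE.
- by move=> c x y; rewrite !in_setE; apply: Vl.
Qed.

Lemma subspace0 V : subspace V -> V 0.
Proof. by case/subspaceP. Qed.

Lemma subspaceD V x y : subspace V -> V x -> V y -> V (x + y).
Proof. by case/subspaceP=> _ Vl Vx Vy; rewrite -[x]scale1r; apply: Vl. Qed.

Lemma subspaceB V x y : subspace V -> V x -> V y -> V (x - y).
Proof.
by case/subspaceP=> _ Vl Vx Vy; rewrite addrC -scaleN1r; apply: Vl.
Qed.

Lemma subspace_spanned S : subspace (spanned S).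
Proof.
apply/subspaceP; split=> [V [/subspace0 //]|c x y Sx Sy V VS].
have /subspaceP[_ Vl] := VS.1.
by apply: Vl; [apply: Sx | apply: Sy].
Qed.

Lemma spanned_sub S V : subspace V -> S `<=` V -> spanned S `<=` V.
Proof. exact: smallest_sub. Qed.

Lemma spannedS S T : S `<=` T -> spanned S `<=` spanned T.
Proof. by apply: sub_smallest2r; apply: subspace_spanned. Qed.

Lemma subspace_preimage (phi : A -> A) V :
  linear phi -> subspace V -> subspace (phi @^-1` V).
Proof.
move=> phil Vs; have /subspaceP[V0 Vl] := Vs; apply/subspaceP; split=> /=.
  (* The scalar -1 at 0, 0 turns linearity into phi 0 = - phi 0 + phi 0 = 0. *)
  by have := phil (-1) 0 0; rewrite scaler0 addr0 scaleN1r addNr => ->.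
by move=> c x y; rewrite phil; apply: Vl.
Qed.

Lemma spanned_linear (phi : A -> A) S V : linear phi -> subspace V ->
  (forall x, S x -> V (phi x)) -> forall x, spanned S x -> V (phi x).
Proof. by move=> phil Vs; apply: spanned_sub; apply: subspace_preimage. Qed.

Lemma linear_numull (a : A) : linear (numul a).
Proof. by move=> c x y; rewrite numulDr numulZr. Qed.

Lemma linear_numulr (a : A) : linear (numul^~ a).
Proof. by move=> c x y; rewrite numulDl numulZl. Qed.

Lemma numulBl x y (a : A) : numul (x - y) a = numul x a - numul y a.
Proof. by rewrite addrC -scaleN1r linear_numulr scaleN1r addrC. Qed.

Lemma numulBr x y (a : A) : numul a (x - y) = numul a x - numul a y.
Proof. by rewrite addrC -scaleN1r linear_numull scaleN1r addrC. Qed.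

Lemma numul0l (a : A) : numul 0 a = 0.
Proof. by have := numulBl 0 0 a; rewrite !subrr. Qed.

Lemma numul0r (a : A) : numul a 0 = 0.
Proof. by have := numulBr 0 0 a; rewrite !subrr. Qed.

(** The vectors that admit such a [t] form a subspace containing [S]: concatenating two lists
    handles linear combinations. *)
Lemma spanned_finitary S x : spanned S x ->
  exists2 t : seq A, [set` t] `<=` S & spanned [set` t] x.
Proof.
move: x; apply: spanned_sub => [|x Sx]; last first.
  exists [:: x] => [y /=|]; first by rewrite inE => /eqP->.
  by apply: sub_gen_smallest; rewrite /= inE.
apply/subspaceP; split=> [|c x y [t tS tx] [u uS uy]].
  by exists [::]; [| by apply: subspace0; apply: subspace_spanned].
exists (t ++ u) => [z /=|].
  by rewrite mem_cat => /orP[/tS|/uS].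
have /subspaceP[_] := subspace_spanned [set` t ++ u]; apply.
  by apply: spannedS tx => z /= zt; rewrite mem_cat zt.
by apply: spannedS uy => z /= zu; rewrite mem_cat zu orbT.
Qed.

(** A finite spanning list need not consist of elements of [S], but each of its entries involves
    only finitely many of them. This will give a spanning list of genuine commutators, whose right
    entries can then be extracted. *)
Lemma finite_dimensional_spanned S : finite_dimensional (spanned S) ->
  exists2 t : seq A, [set` t] `<=` S & spanned S = spanned [set` t].
Proof.
case=> s Ss.
suff [t tS st] : exists2 t : seq A, [set` t] `<=` S &
    [set` s] `<=` spanned [set` t].
  exists t => //; apply/seteqP; split; last exact: spannedS.
  by rewrite Ss; apply: spanned_sub => //; apply: subspace_spanned.
have {Ss} : [set` s] `<=` spanned S by rewrite Ss; apply: sub_gen_smallest.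
elim: s => [|x s IHs] sS; first by exists [::].
have [y /= ys|t tS st] := IHs; first by apply: sS; rewrite /= inE ys orbT.
have [|u uS ux] := @spanned_finitary S x.
  by apply: sS; rewrite /= inE eqxx.
exists (u ++ t) => [z /=|z /=]; first by rewrite mem_cat => /orP[/uS|/tS].
rewrite inE => /orP[/eqP->|zs].
  by apply: spannedS ux => y /= yu; rewrite mem_cat yu.
by apply: spannedS (st _ zs) => y /= yt; rewrite mem_cat yt orbT.
Qed.

Lemma ideal_ideal_generated S : two_sided_ideal (ideal_generated S).
Proof.
split; last first.
  by move=> a x Sx; split=> I IS; have [] := IS.1.2 a x (Sx I IS).
apply/subspaceP; split=> [I [[/subspace0 //]]|c x y Sx Sy I IS].
have /subspaceP[_ Il] := IS.1.1.
by apply: Il; [apply: Sx | apply: Sy].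
Qed.

(** * The ideal generated by the commutators [v, b] with v in [V] *)

Section CommutatorIdeal.
Context (V : set A).

Definition commutators : set A :=
  [set x | exists2 v, V v & exists b, x = numul v b - numul b v].

Let S := spanned commutators.

Let commS v b : V v -> S (numul v b - numul b v).
Proof. by move=> Vv; apply: sub_gen_smallest; exists v => //; exists b. Qed.

(** Leibniz rule for the derivation [v, -], solved for [v, b] c. *)
Let mul_commE (v b c : A) : numul (numul v b - numul b v) c =
  (numul v (numul b c) - numul (numul b c) v)
  - numul b (numul v c - numul c v).
Proof. by rewrite numulBl numulBr !numulA opprB addrA subrK. Qed.

(** This is S + A S; without a unit, A S need not contain S. *)
Let J := spanned (commutators `|`
  [set x | exists a, exists2 y, commutators y & x = numul a y]).

Let J_ideal : two_sided_ideal J.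
Proof.
have Js : subspace J by exact: subspace_spanned.
have SJ x : commutators x -> J x by move=> Sx; apply: sub_gen_smallest; left.
have ASJ a x : commutators x -> J (numul a x).
  by move=> Sx; apply: sub_gen_smallest; right; exists a, x.
have SAJ x a : commutators x -> J (numul x a).
  move=> [v Vv [b ->]]; rewrite mul_commE; apply: (subspaceB Js).
    by apply: SJ; exists v => //; exists (numul b a).
  by apply: ASJ; exists v => //; exists a.
split=> // a x Jx; split.
  apply: (spanned_linear (linear_numull a)) Jx => // y [|[b [z Sz ->]]].
    exact: ASJ.
  by rewrite numulA; apply: ASJ.
apply: (spanned_linear (linear_numulr a)) Jx => // y [|[b [z Sz ->]]].
  exact: SAJ.
(* Here (b [v, c]) a = b [v, c a] - (b c) [v, a], and both terms lie in A S. *)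
case: Sz => v Vv [c ->]; rewrite -numulA mul_commE numulBr.
apply: (subspaceB Js); first by apply: ASJ; exists v => //; exists (numul c a).
by rewrite numulA; apply: ASJ; exists v => //; exists a.
Qed.

Lemma finite_dimensional_commutator_ideal :
  finite_dimensional S -> finite_dimensional (ideal_generated commutators).
Proof.
move=> /finite_dimensional_spanned[t tS St].
(* Choose a right entry [b x] for each commutator x = [v, b x], with 0 as default elsewhere. The
   left entry v may stay existential, as only right entries occur in the spanning list. *)
have /choice[b bP] : forall x, exists b, commutators x ->
    exists2 v, V v & x = numul v b - numul b v.
  move=> x; case: (pselect (commutators x)) => [[v Vv [b xE]]|NSx].
    by exists b => _; exists v.
  by exists 0.
(* As [t] spans S, these products span the sum of the spaces S (b y), y in [t]. *)
pose T := [seq numul x (b y) | x <- t, y <- t].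
exists (t ++ T).
have Ts := subspace_spanned [set` t ++ T].
have ST x : S x -> spanned [set` t ++ T] x.
  by rewrite /S St; apply: spannedS => y /= yt; rewrite mem_cat yt.
have SbT x y : y \in t -> S x -> spanned [set` t ++ T] (numul x (b y)).
  move=> yt; rewrite /S St.
  apply: (spanned_linear (linear_numulr (b y))) => // z zt.
  apply: sub_gen_smallest; rewrite /= mem_cat; apply/orP; right.
  by apply/allpairsP; exists (z, y).
have [Is Im] := ideal_ideal_generated commutators.
have SI : commutators `<=` ideal_generated commutators.
  exact: sub_gen_smallest.
apply/seteqP; split; last first.
  apply: spanned_sub => // x /=; rewrite mem_cat => /orP[/tS/SI //|].
  by case/allpairsP=> -[y z] /= [/tS/SI Iy _ ->]; have [] := Im (b z) y Iy.
(* The ideal lies in [J], so only the generators of [J] have to be placed in the span. *)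
apply: subset_trans (smallest_sub J_ideal _) _.
  by move=> x Sx; apply: sub_gen_smallest; left.
apply: spanned_sub => // x [Sx|[a [y Sy ->]]].
  by apply: ST; apply: sub_gen_smallest.
have {Sy} : S y by apply: sub_gen_smallest.
rewrite /S St; apply: (spanned_linear (linear_numull a)) => // {}y yt.
have [v Vv yE] := bP _ (tS _ yt).
(* The arbitrary factor [a] is absorbed into the commutators [v, a (b y)] and [v, a]; the only outer
   factor left is [b y], which ranges over a finite list. *)
have -> : numul a y = (numul v (numul a (b y)) - numul (numul a (b y)) v)
    - numul (numul v a - numul a v) (b y).
  by rewrite mul_commE -yE opprB addrC subrK.
by apply: (subspaceB Ts); [apply: ST | apply: SbT => //]; apply: commS.
Qed.

End CommutatorIdeal.

End Subspaces.

(** * Evaluation of polynomials and the values of g *)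

Section Evaluation.
Context (K : fieldType) (A : nuAlgType K) (a : nat -> A).
Implicit Types (p q : {ncpoly K}) (w : {fmonom nat}).

Lemma ncevalEw (d : {fset {fmonom nat}}) p : (msupp p `<=` d)%fset ->
  nceval a p = \sum_(w <- d) p@_w *: word_eval a w.
Proof.
move=> pd; rewrite /nceval (big_fset_incl _ pd) // => w _ /mcoeff_outdom->.
by rewrite scale0r.
Qed.

Lemma nceval_is_linear : linear (nceval a).
Proof.
move=> c p q.
(* A common index set for the three sums, whose supports may differ through cancellation. *)
pose d := (msupp p `|` msupp q `|` msupp (c *: p + q))%fset.
have pd : (msupp p `<=` d)%fset by rewrite /d -fsetUA fsubsetUl.
have qd : (msupp q `<=` d)%fset by rewrite /d fsetUAC fsubsetUr.
rewrite (ncevalEw (fsubsetUr _ _ : (_ `<=` d)%fset)).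
rewrite (ncevalEw pd) (ncevalEw qd).
rewrite scaler_sumr -big_split; apply: eq_bigr => w _ /=.
by rewrite mcoeffD mcoeffZ scalerDl scalerA.
Qed.

HB.instance Definition _ :=
  GRing.isLinear.Build K {ncpoly K} A *:%R (nceval a) nceval_is_linear.

Lemma ncevalU (c : K) w : nceval a << c *g w >> = c *: word_eval a w.
Proof. by rewrite (ncevalEw msuppU_le) big_seq_fset1 mcoeffUU. Qed.

Lemma foldl_numulE (x y : A) (s : seq nat) :
  foldl (fun b j => numul b (a j)) (numul x y) s =
  numul x (foldl (fun b j => numul b (a j)) y s).
Proof. by elim: s y => //= j s IHs y; rewrite -numulA IHs. Qed.

(** The empty word must be excluded: its dummy value 0 would give 0 on the right, against [a i] on
    the left. *)
Lemma word_eval_fmonomU w i : w != mone ->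
  word_eval a (mmul w (fmu i)) = numul (word_eval a w) (a i).
Proof.
rewrite /word_eval fmP fm1 fmM fmU.
by case: (fmonom_val w) => [|j s] //= _; rewrite foldl_cat.
Qed.

Lemma word_eval_Ufmonom w i : w != mone ->
  word_eval a (mmul (fmu i) w) = numul (a i) (word_eval a w).
Proof.
rewrite /word_eval fmP fm1 fmM fmU.
by case: (fmonom_val w) => [|j s] //= _; rewrite foldl_numulE.
Qed.

Lemma const_free_msupp p w : const_free p -> w \in msupp p -> w != mone.
Proof.
by move=> p0; rewrite -mcoeff_neq0; apply: contra_neq => ->.
Qed.

Lemma nceval_mulX p i : const_free p ->
  nceval a (p * ncX K i) = numul (nceval a p) (a i).
Proof.
move=> p0; rewrite malgME linear_sum.
transitivity (\sum_(w <- msupp p) numul (p@_w *: word_eval a w) (a i)).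
  apply: eq_big_seq => w wp.
  rewrite msuppU1 big_seq_fset1 mcoeffUU mulr1 /= ncevalU.
  by rewrite word_eval_fmonomU ?numulZl // (const_free_msupp p0).
symmetry; apply: (big_morph (numul^~ (a i))) => [x y|].
  exact: numulDl.
exact: numul0l.
Qed.

Lemma nceval_Xmul p i : const_free p ->
  nceval a (ncX K i * p) = numul (a i) (nceval a p).
Proof.
move=> p0; rewrite malgME msuppU1 big_seq_fset1 linear_sum.
transitivity (\sum_(w <- msupp p) numul (a i) (p@_w *: word_eval a w)).
  apply: eq_big_seq => w wp.
  rewrite mcoeffUU mul1r /= ncevalU.
  by rewrite word_eval_Ufmonom ?numulZr // (const_free_msupp p0).
symmetry; apply: (big_morph (numul (a i))) => [x y|].
  exact: numulDr.
exact: numul0r.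
Qed.

Lemma nceval_commutatorX p i : const_free p ->
  nceval a (commutator p (ncX K i)) =
  numul (nceval a p) (a i) - numul (a i) (nceval a p).
Proof. by move=> p0; rewrite linearB /= nceval_mulX // nceval_Xmul. Qed.

End Evaluation.

(** The variable of index [n] does not occur in [f], so its value can be chosen independently of the
    value of [f]. *)
Lemma values_commutatorX (K : fieldType) (A : nuAlgType K) (n : nat)
    (f : {ncpoly K}) : const_free f -> in_vars n f ->
  values A (commutator f (ncX K n)) = commutators (values A f).
Proof.
move=> f0 fn; apply/seteqP; split=> x.
  case=> a _ <-; exists (nceval a f); first by exists a.
  by exists (a n); rewrite nceval_commutatorX.
case=> _ [a _ <-] [b ->].
(* Reassigning index [n] to [b] leaves the value of [f] unchanged. *)
exists (fun i => if i == n then b else a i) => //.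
rewrite nceval_commutatorX // eqxx.
rewrite (eq_nceval (b := a) fn) // => i lt_in.
by rewrite ltn_eqF.
Qed.

Theorem theorem1p9 (K : fieldType) (n : nat) (f : {ncpoly K})
    (f0 : const_free f) (fn : in_vars n f) :
  ideally_concise (commutator f (ncX K n)).
Proof.
move=> A; rewrite values_commutatorX //.
exact: finite_dimensional_commutator_ideal.
Qed.
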